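(* Let $n\geq 2$ be an integer, $b:=-n+i$, $D=\{0,m\}$ with $2\le m\le n^2$. Let $\alpha\in E_{n,D}$ and suppose there is exactly one sequence $(\alpha_j)_{j\ge1}$ with $\alpha_j\in\{0,\pm m\}$ and $\alpha=\sum_{j\ge1}\alpha_jb^{-j}$. Let $\gamma:=\sum_{j\ge1}\gamma_jb^{-j}$ where $\gamma_j:=\min(D\cap(D+\alpha_j))$, and let $C(\alpha):=C_{n,D}\cap(C_{n,D}+\alpha)$. (a) If $C(\alpha)$ is self-similar and is the attractor of an IFS (finite family of contracting similarities) containing a similarity of the form $f(x)=rx+(1-r)\gamma$, then $(m-|\alpha_j|)_{j\ge1}$ is strongly eventually periodic. (b) Conversely, if $(m-|\alpha_j|)_{j\ge1}$ is strongly eventually periodic, written as $a_1,\ldots,a_p$ followed by the infinite repetition of $a_1+u_1,\ldots,a_p+u_p$ (with $u_\ell\ge0$), then $C(\alpha)$ is self-similar and is the attractor of the IFS consisting of all maps of the form $$f(x)=b^{-p}\Big(x+\sum_{\ell=1}^p\big(y_\ell b^{p-\ell}+z_\ell b^{-\ell}\big)-\gamma\Big)+\gamma,$$ where for each $\ell$, $y_\ell,z_\ell\in\{0,m\}$ with $y_\ell\le a_\ell$ and $z_\ell\le u_\ell$.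
   Context: $C_{n,D}$ is the attractor of $\{z\mapsto b^{-1}(z+d): d\in D\}$, i.e. $C_{n,D}=\{\sum_{j\ge1}d_jb^{-j}: d_j\in D\}$. $E_{n,D}$ is the attractor of $\{z\mapsto b^{-1}(z+\delta):\delta\in D-D\}$. A set is self-similar if it is the attractor of a finite family of contracting similarities. A sequence $(a_j)_{j\ge1}$ of integers is strongly eventually periodic (SEP) if there exist $p\ge1$, integers $(b_\ell)_{\ell=1}^p$ and nonnegative integers $(c_\ell)_{\ell=1}^p$ such that $(a_j)$ equals $b_1,\ldots,b_p$ followed by the infinite repetition of $b_1+c_1,\ldots,b_p+c_p$. *)

(* Defs.v *)
From HB Require Import structures.
From mathcomp Require Import all_boot all_order all_algebra.
From mathcomp Require Import complex.
From mathcomp Require Import all_classical all_reals all_analysis.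
Unset Printing Implicit Defensive.
Import Order.TTheory GRing.Theory Num.Theory.
Import numFieldTopology.Exports numFieldNormedType.Exports.
Local Open Scope ring_scope.
Local Open Scope classical_set_scope.

Notation Cx R := ((R[i])^o).

Definition bb (R : realType) (n : nat) : Cx R := - (n%:R) + Complex 0 1.

Definition inD (m : nat) (x : int) : Prop := x = 0 \/ x = m%:Z.

Definition inDD (m : nat) (x : int) : Prop :=
  exists d1 d2, inD m d1 /\ inD m d2 /\ x = d1 - d2.

(* Digit sequences are indexed from 0: d k is the digit d_{k+1} of the paper,
   so the k-th term of the series is d_{k+1} b^{-(k+1)}. *)
Definition digit_term (R : realType) (n : nat) (d : nat -> int) : nat -> Cx R :=
  fun k => (d k)%:~R * bb R n ^- k.+1.

Definition represents (R : realType) (n : nat) (d : nat -> int) (z : Cx R) : Prop :=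
  series (digit_term R n d) @ \oo --> z.

Definition C_nD (R : realType) (n m : nat) : set (Cx R) :=
  [set z | exists d : nat -> int, (forall k, inD m (d k)) /\ represents R n d z].

Definition E_nD (R : realType) (n m : nat) : set (Cx R) :=
  [set z | exists d : nat -> int, (forall k, inDD m (d k)) /\ represents R n d z].

Definition C_alpha (R : realType) (n m : nat) (alpha : Cx R) : set (Cx R) :=
  C_nD R n m `&` [set c + alpha | c in C_nD R n m].

(* gamma_j = min (D \cap (D + a)) for D = {0, m}, m > 0:
   D \cap (D + a) is a subset of {0, m}; its minimum is 0 when 0 lies in
   D + a (i.e. -a in D), and m otherwise. *)
Definition gamma_digit (m : nat) (a : int) : int :=
  if (- a == 0) || (- a == m%:Z) then 0 else m%:Z.

Definition gamma (R : realType) (n m : nat) (a : nat -> int) : Cx R :=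
  limn (series (digit_term R n (fun k => gamma_digit m (a k)))).

Definition contracting_similarity (R : realType) (f : Cx R -> Cx R) : Prop :=
  exists r : R, 0 < r < 1 /\ forall x y : Cx R, `|f x - f y| = (r%:C)%C * `|x - y|.

Definition IFS (R : realType) (F : set (Cx R -> Cx R)) : Prop :=
  finite_set F /\ F !=set0 /\ (forall f, F f -> contracting_similarity R f).

(* K is the attractor of F: the (unique, by Hutchinson) nonempty compact set
   with K = \bigcup_{f in F} f(K). *)
Definition attractor (R : realType) (F : set (Cx R -> Cx R)) (K : set (Cx R)) : Prop :=
  compact K /\ K !=set0 /\ K = \bigcup_(f in F) (f @` K).

Definition self_similar (R : realType) (K : set (Cx R)) : Prop :=
  exists F : set (Cx R -> Cx R), IFS R F /\ attractor R F K.

Definition SEP (s : nat -> int) : Prop :=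
  exists p : nat, (0 < p)%N /\
  exists (bs : nat -> int) (cs : nat -> nat),
    forall k, s k = if (k < p)%N then bs k else bs (k %% p)%N + (cs (k %% p)%N)%:Z.

(* Main.v *)
Require Import Defs.
From HB Require Import structures.
From mathcomp Require Import all_boot all_order all_algebra.
From mathcomp Require Import complex.
From mathcomp Require Import all_classical all_reals all_analysis.
Import Order.TTheory GRing.Theory Num.Theory.
Import numFieldTopology.Exports numFieldNormedType.Exports.
Local Open Scope ring_scope.
Local Open Scope classical_set_scope.

(** Since [|b| > 2], an expansion in base [b] with digits in [{0, m}] is
    determined by its value. The uniqueness of the expansion of [alpha] gives
    [C(alpha) = gamma + T], where [T] consists of the values of the expansions
    whose digits lie in [{0, m}] and satisfy [e_k <= s_k], [s_k = m - |alpha_k|].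

    (a) A similarity fixing [gamma] with ratio [r] gives [r T <= T]. If [k0] is
    the first position with [s_k0 = m] and [r m b^-k0 = sum_k e_k b^-k], then for
    any [j] with [s_j = m] the point [r m b^-j] has the digits [e] shifted by
    [j - k0], so [e_k = m] implies [s_(j + k - k0) = m]. As [r <> 0, 1], some
    [p = k - k0] is positive; [s_j <= s_(j+p)] for all [j] forces [s] to be
    strongly eventually periodic, with period a large multiple of [p].

    (b) Prepending a block [y] to the digits of a point of [T] and adding [z] to
    its first block stays in [T] because [a_l + u_l <= m]; conversely every
    expansion splits in this way. Compactness holds because [T] is a continuous
    image of a closed subset of the Cantor space. *)

(* [cvgD] unifies very slowly at [Cx R], so it is specialised over an abstract
   field. *)
Lemma cvgD_regular (K : numFieldType) (u v : nat -> K^o) (x y : K^o) :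
  u @ \oo --> x -> v @ \oo --> y -> (fun k => u k + v k) @ \oo --> x + y.
Proof. exact: cvgD. Qed.

Lemma continuous_addr_regular (K : numFieldType) (c : K^o) :
  continuous (fun x : K^o => x + c).
Proof.
move=> x; apply: (@cvgD K K^o _ (nbhs x) _ id (fun=> c) x c).
  exact: cvg_id.
exact: cvg_cst.
Qed.

(** * Convergence and arithmetic of expansions in base [b] *)

Section Expansions.
Context {R : realType} (n : nat).
Hypothesis n_ge2 : (2 <= n)%N.
Implicit Types (d e : nat -> int) (z w : Cx R).

Local Notation b := (bb R n).

Lemma norm_bb_sqr : `|b| ^+ 2 = (n ^ 2).+1%:R.
Proof.
have -> : b = (- n%:R +i* 1)%C.
  rewrite /bb; apply/eqP; rewrite eq_complex /= -[n%:R]/((n%:R : R[i])).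
  by rewrite -(rmorph_nat (real_complex R)) /= addr0 oppr0 add0r !eqxx.
rewrite normc_def /= -rmorphXn /= sqr_sqrtr ?addr_ge0 ?sqr_ge0//.
by rewrite sqrrN expr1n -natrX natr1 rmorph_nat.
Qed.

Lemma norm_bb_gt2 : 2 < `|b|.
Proof.
rewrite -(@ltr_pXn2r _ 2) ?nnegrE// norm_bb_sqr -natrX ltr_nat.
by rewrite ltnS leq_exp2r.
Qed.

Lemma bb_neq0 : b != 0.
Proof. by rewrite -normr_gt0 (lt_trans _ norm_bb_gt2). Qed.

Lemma norm_bbV_lt : `|b^-1| < 2^-1.
Proof. by rewrite normfV ltf_pV2 ?norm_bb_gt2 ?posrE ?normr_gt0 ?bb_neq0. Qed.

Lemma cvg_complex (u : nat -> Cx R) (x y : R) :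
  (fun k => complex.Re (u k)) @ \oo --> x ->
  (fun k => complex.Im (u k)) @ \oo --> y ->
  u @ \oo --> ((x +i* y)%C : Cx R).
Proof.
move=> /cvgrPdist_lt ux /cvgrPdist_lt uy; apply/cvgrPdist_le => eps.
(* A positive element of [R[i]] is real, so half of its real part can serve as the tolerance for
   each coordinate. *)
rewrite complex.ltcE /= => /andP[/eqP eps_im eps_re].
have e2 : 0 < complex.Re eps / 2 by rewrite divr_gt0.
near=> k.
rewrite [leRHS]complexE eps_im mulr0 addr0.
case uk : (u k) => [v w].
rewrite [X in `|X|]complexE; apply: (le_trans (ler_normD _ _)).
rewrite normrM !normc_def /= expr0n expr1n /= !addr0 add0r sqrtr1 mul1r !sqrtr_sqr.
rewrite -rmorphD lecR (splitr (complex.Re eps)) ltW// ltrD//.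
- by have := near (ux _ e2) k; rewrite uk; apply.
- by have := near (uy _ e2) k; rewrite uk; apply.
Unshelve. all: by end_near. Qed.

Lemma norm_Re_le z : `|complex.Re z|%:C%C <= `|z|.
Proof.
rewrite normc_def lecR -sqrtr_sqr ler_sqrt ?addr_ge0 ?sqr_ge0//.
by rewrite lerDl sqr_ge0.
Qed.

Lemma norm_Im_le z : `|complex.Im z|%:C%C <= `|z|.
Proof.
rewrite normc_def lecR -sqrtr_sqr ler_sqrt ?addr_ge0 ?sqr_ge0//.
by rewrite lerDr sqr_ge0.
Qed.

Lemma norm_digit_term_le (M : nat) d k : `|d k| <= M%:Z ->
  `|digit_term R n d k| <= M%:R * 2^-1 ^+ k.+1.
Proof.
move=> dM; rewrite /digit_term normrM -exprVn normrX ler_pM ?exprn_ge0//.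
  by rewrite -intr_norm -[M%:R]/(M%:Z%:~R) ler_int.
by rewrite lerXn2r ?nnegrE ?invr_ge0// ltW ?norm_bbV_lt.
Qed.

(** Real and imaginary parts are additive and dominated by the modulus. Each is thus a real series
    bounded by a geometric one of ratio [1/2], and [cvg_complex] combines the two limits. *)
Lemma is_cvg_digits (M : nat) d : (forall k, `|d k| <= M%:Z) ->
  cvgn (series (digit_term R n d)).
Proof.
move=> dM.
have cvg_part (g : {additive R[i] -> R}) : (forall z, `|g z|%:C%C <= `|z|) ->
    cvgn (g \o series (digit_term R n d)).
  move=> gle.
  have -> : g \o series (digit_term R n d) = series (g \o digit_term R n d).
    by apply/funext => k; rewrite /series /= raddf_sum.
  apply: normed_cvg; apply: (@series_le_cvg _ _ (geometric (M%:R / 2) (2^-1))).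
  - by move=> k; exact: normr_ge0.
  - by move=> k; rewrite /geometric /= mulr_ge0 ?divr_ge0 ?exprn_ge0.
  - move=> k; rewrite -lecR /= (le_trans (gle _))//.
    rewrite (le_trans (norm_digit_term_le M _ _ (dM k)))//.
    by rewrite !(rmorphM, rmorphXn, fmorphV, rmorph_nat) exprS mulrA.
  - by apply: is_cvg_geometric_series; rewrite ger0_norm// invf_lt1// ltr1n.
have /cvg_ex[x xP] := cvg_part (@complex.Re R) norm_Re_le.
have /cvg_ex[y yP] := cvg_part (@complex.Im R) norm_Im_le.
by apply/cvg_ex; exists (x +i* y)%C; exact: cvg_complex.
Qed.

Local Notation repr := (represents R n).

Lemma represents_lim (M : nat) d : (forall k, `|d k| <= M%:Z) ->
  repr d (limn (series (digit_term R n d))).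
Proof. exact: is_cvg_digits. Qed.

Lemma represents_unique d z w : repr d z -> repr d w -> z = w.
Proof. by move=> dz dw; apply: (cvg_unique _ dz dw); exact: norm_hausdorff. Qed.

Lemma representsD d e z w : repr d z -> repr e w ->
  repr (fun k => d k + e k) (z + w).
Proof.
move=> dz ew; rewrite /represents.
have -> : series (digit_term R n (fun k => d k + e k)) =
    series (digit_term R n d) + series (digit_term R n e).
  apply/funext => k; rewrite /series /= fctE -big_split /=.
  by apply: eq_bigr => i _; rewrite /digit_term intrD mulrDl.
exact: (cvgD_regular _ _ _ _ _ dz ew).
Qed.

Lemma representsN d z : repr d z -> repr (fun k => - d k) (- z).
Proof.
move=> dz; rewrite /represents.
have -> : series (digit_term R n (fun k => - d k)) =
    - series (digit_term R n d).
  apply/funext => k; rewrite /series /= fctE -sumrN.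
  by apply: eq_bigr => i _; rewrite /digit_term intrN mulNr.
exact: cvgN.
Qed.

Lemma representsB d e z w : repr d z -> repr e w ->
  repr (fun k => d k - e k) (z - w).
Proof. by move=> dz /representsN; exact: representsD. Qed.

Lemma represents0 : repr (fun=> 0) 0.
Proof.
rewrite /represents (_ : series _ = fun=> 0); first exact: cvg_cst.
by apply/funext => k; rewrite /series /= big1// => i _; rewrite /digit_term mul0r.
Qed.

(** Horner's rule; in the limit it allows a leading digit to be removed or added. *)
Lemma series_digit_termS d k : series (digit_term R n d) k.+1 =
  b^-1 * ((d 0%N)%:~R + series (digit_term R n (d \o succn)) k).
Proof.
rewrite /series /= big_nat_recl// mulrDr /digit_term expr1 mulrC mulr_sumr.
by congr (_ + _); apply: eq_bigr => i _; rewrite mulrCA -!exprVn -exprS.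
Qed.

Lemma represents_behead d z : repr d z ->
  repr (d \o succn) (b * z - (d 0%N)%:~R).
Proof.
rewrite {1}/represents -cvg_shiftS /= => dz.
rewrite /represents (_ : series _ = (fun k => b * series (digit_term R n d) k.+1
   - (d 0%N)%:~R)).
  by apply: cvgB; [apply: cvgMr | exact: cvg_cst].
apply/funext => k; rewrite series_digit_termS mulVKf ?bb_neq0//.
by rewrite addrAC subrr add0r.
Qed.

Lemma represents_cons d z : repr (d \o succn) z ->
  repr d (b^-1 * ((d 0%N)%:~R + z)).
Proof.
move=> dz; rewrite /represents -cvg_shiftS /=.
rewrite (_ : (fun k => _) = (fun k => b^-1 * ((d 0%N)%:~R +
  series (digit_term R n (d \o succn)) k))).
  by apply: cvgMr; apply: (cvgD_regular _ _ _ _ _ (cvg_cst _) dz).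
by apply/funext => k; rewrite series_digit_termS.
Qed.

Lemma norm_represents_le (M : nat) d z : (forall k, `|d k| <= M%:Z) ->
  repr d z -> `|z| <= M%:R.
Proof.
move=> dM /cvgrPdist_lt dz; apply/ler_addgt0Pr => eps /dz[N _ /(_ N (leqnn N))].
move=> zN; rewrite -(subrK (series (digit_term R n d) N) z).
apply: (le_trans (ler_normD _ _)); rewrite addrC lerD ?(ltW zN)//.
(* The right-hand side is the exact partial sum of the dominating geometric series, which lets the
   induction close. *)
have : `|series (digit_term R n d) N| <= M%:R * (1 - 2^-1 ^+ N).
  rewrite /series /=; elim: N {zN} => [|N IH].
    by rewrite big_geq// normr0 expr0 subrr mulr0.
  rewrite big_nat_recr//= (le_trans (ler_normD _ _))//.
  rewrite (le_trans (lerD IH (norm_digit_term_le M _ _ (dM N))))//.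
  rewrite -mulrDr exprS; set t := 2^-1 ^+ N.
  suff -> : 1 - t + 2^-1 * t = 1 - 2^-1 * t by [].
  by rewrite {1}(splitr t) [t / 2]mulrC opprD addrA subrK.
move=> /le_trans; apply; rewrite ler_piMr// lerBlDr lerDl exprn_ge0//.
Qed.

End Expansions.

(** * Uniqueness of expansions with digits in [{0, m}], and cutting and joining of expansions *)

Section Uniqueness.
Context {R : realType} (n m : nat).
Hypotheses (n_ge2 : (2 <= n)%N) (m_gt0 : (0 < m)%N).
Implicit Types (d e : nat -> int) (z w : Cx R).

Local Notation b := (bb R n).
Local Notation repr := (represents R n).

Lemma inD_ge0 x : inD m x -> 0 <= x.
Proof. by case=> ->. Qed.

Lemma inD_norm_le x : inD m x -> `|x| <= m%:Z.
Proof. by case=> ->. Qed.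

(* A nonzero leading digit would leave a remainder of modulus [m], but the
   remainder [(d_1 + w) / b] has modulus at most [2 m / |b| < m]. *)
Lemma represents0_eq0 d : (forall k, d k = 0 \/ `|d k| = m%:Z) ->
  repr d 0 -> forall k, d k = 0.
Proof.
(* The leading digit is enough: once it vanishes, the tail represents 0 again. *)
suff head_eq0 e : (forall k, e k = 0 \/ `|e k| = m%:Z) -> repr e 0 -> e 0%N = 0.
  move=> dm d0 k; elim: k d dm d0 => [|k IH] d dm d0; first exact: head_eq0.
  apply: (IH (d \o succn)) => [i|]; first exact: dm.
  have := represents_behead n n_ge2 _ _ d0.
  by rewrite (head_eq0 d dm d0) mulr0 mulr0z subr0.
move: e => {}d dm d0.
have dle i : `|d i| <= m%:Z by case: (dm i) => ->.
case: (dm 0%N) => // d0m; exfalso.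
have r1 := represents_behead n n_ge2 _ _ d0.
have r2 := represents_behead n n_ge2 _ _ r1.
have := norm_represents_le n n_ge2 m _ _ (fun i => dle i.+2) r2.
rewrite mulr0 sub0r /= => le2.
have : `|b * - (d 0%N)%:~R| <= m%:R + m%:R.
  rewrite -(subrK (d 1%N)%:~R (b * _)) (le_trans (ler_normD _ _))// lerD//.
  by rewrite -intr_norm -[m%:R]/(m%:Z%:~R) ler_int.
rewrite normrM normrN -intr_norm d0m -[m%:Z%:~R]/(m%:R).
rewrite -mulr2n -(mulr_natl m%:R 2) ler_pM2r ?ltr0n//.
by rewrite (lt_geF (norm_bb_gt2 _ n_ge2)).
Qed.

(** Differences of digits in [{0, m}] are 0 or [±m], the case covered by [represents0_eq0]. Digits
    in [{0, ±m}] could differ by [2m], which that lemma does not cover. *)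
Lemma represents_inj d e z : (forall k, inD m (d k)) -> (forall k, inD m (e k)) ->
  repr d z -> repr e z -> d = e.
Proof.
move=> dD eD dz ez; apply/funext => k; apply/eqP; rewrite -subr_eq0; apply/eqP.
apply: (represents0_eq0 (fun k => d k - e k)) => [i|].
  by case: (dD i) (eD i) => -> [] ->; rewrite ?(subrr, sub0r, subr0, normrN); auto.
by rewrite -(subrr z); exact: representsB.
Qed.

Lemma represents_cat p d z : repr (fun k => d (p + k)%N) z ->
  repr d (\sum_(l < p) (d l)%:~R * b ^- l.+1 + b ^- p * z).
Proof.
elim: p d z => [|p IH] d z dz.
  by rewrite big_ord0 add0r expr0 invr1 mul1r.
have := represents_cons n d _ (IH (d \o succn) z dz).
congr represents; rewrite big_ord_recl /= addrA !mulrDr mulrA -invfM -exprS.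
congr (_ + _ + _); first by rewrite mulrC expr1.
rewrite mulr_sumr; apply: eq_bigr => i _.
by rewrite mulrCA -invfM -exprS.
Qed.

Lemma represents_drop p d z : repr d z ->
  repr (fun k => d (p + k)%N)
    (b ^+ p * (z - \sum_(l < p) (d l)%:~R * b ^- l.+1)).
Proof.
elim: p d z => [|p IH] d z dz; first by rewrite big_ord0 subr0 mul1r.
have := IH _ _ (represents_behead n n_ge2 _ _ dz).
congr represents.
rewrite big_ord_recl /= exprSr -!mulrA; congr (_ * _).
rewrite opprD addrA !mulrBr expr1 mulrCA divff ?bb_neq0// mulr1; congr (_ - _).
rewrite mulr_sumr; apply: eq_bigr => i _.
by rewrite mulrCA [b ^+ _.+2]exprS invfM mulVKf ?bb_neq0.
Qed.

Lemma represents_shift p d z : repr d z ->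
  repr (fun k => if (k < p)%N then 0 else d (k - p)%N) (b ^- p * z).
Proof.
move=> dz; have := represents_cat p (fun k => if (k < p)%N then 0 else d (k - p)%N) z.
rewrite big1 ?add0r; last by move=> i _; rewrite ltn_ord mul0r.
apply; congr (repr _ z): dz; apply/funext => k.
by rewrite ltnNge leq_addr addKn.
Qed.

Lemma represents_take p d :
  repr (fun k => if (k < p)%N then d k else 0) (\sum_(l < p) (d l)%:~R * b ^- l.+1).
Proof.
have := represents_cat p (fun k => if (k < p)%N then d k else 0) 0.
under eq_bigr do rewrite ltn_ord; rewrite mulr0 addr0; apply.
rewrite (_ : (fun k => _) = (fun=> 0)); first exact: represents0.
by apply/funext => k; rewrite ltnNge leq_addr.
Qed.

End Uniqueness.

(** * Description of [C(alpha)] by digits, and compactness *)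

Section DigitSets.
Context {R : realType} (n m : nat).
Hypotheses (n_ge2 : (2 <= n)%N) (m_gt0 : (0 < m)%N).
Implicit Types (d e s : nat -> int) (z w : Cx R).

Local Notation b := (bb R n).
Local Notation repr := (represents R n).

(** When [s k] lies in [{0, m}], position [k] is free if [s k = m] and forced to be 0 if
    [s k = 0]. *)
Definition admissible s e := forall k, inD m (e k) /\ e k <= s k.

Definition digit_set s : set (Cx R) :=
  [set t | exists2 e, admissible s e & repr e t].

(** A digit [±m] of [alpha] determines both digits of [D] whose difference it is and leaves no
    slack; a digit 0 leaves their common value free. *)
Definition slack (a : nat -> int) : nat -> int := fun k => m%:Z - `|a k|.

Lemma inDD_cases x : inDD m x -> [\/ x = 0, x = m%:Z | x = - m%:Z].
Proof.
move=> [d1 [d2 [[] -> [[] -> ->]]]]; rewrite ?(subrr, sub0r, subr0).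
- by constructor 1.
- by constructor 3.
- by constructor 2.
- by constructor 1.
Qed.

Lemma slack_inD a k : inDD m (a k) -> inD m (slack a k).
Proof.
rewrite /slack => /inDD_cases[] ->; rewrite ?normrN ?normr0 ?subr0; first by right.
- by left; rewrite subrr.
- by left; rewrite subrr.
Qed.

Lemma gamma_digitE (x : int) : inDD m x ->
  gamma_digit m x = if x == m%:Z then m%:Z else 0.
Proof.
have m0 : (m%:Z == 0) = false by apply/negbTE; rewrite -lt0n.
rewrite /gamma_digit => /inDD_cases[] ->.
- by rewrite oppr0 eqxx eq_sym m0.
- by rewrite oppr_eq0 m0 /= eqNr m0 eqxx.
- by rewrite opprK eqxx orbT eqNr m0.
Qed.

Lemma gamma_digit_inD (x : int) : inD m (gamma_digit m x).
Proof. by rewrite /gamma_digit; case: ifP => _; [left|right]. Qed.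

Lemma represents_gamma (a : nat -> int) :
  repr (fun k => gamma_digit m (a k)) (gamma R n m a).
Proof.
by apply: (represents_lim n n_ge2 m) => k; exact/inD_norm_le/gamma_digit_inD.
Qed.

(** The digits of [z] are [gamma_k + e_k], and those of [z - alpha] are [gamma_k + e_k - a_k]. Both
    lie in [D] exactly when [e] is admissible for the slack. *)
Lemma C_alphaP (alpha : Cx R) (a : nat -> int) z :
  (forall k, inDD m (a k)) -> repr a alpha ->
  (forall a' : nat -> int, (forall k, inDD m (a' k)) -> repr a' alpha -> a' = a) ->
  C_alpha R n m alpha z <-> digit_set (slack a) (z - gamma R n m a).
Proof.
move=> aDD aalpha a_unique.
have m0 : (m%:Z == 0) = false by apply/negbTE; rewrite -lt0n.
split.
  move=> [[x [xD xz]] [c [y [yD yc]] cz]].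
  (* The digit differences of [z] and [c] expand [alpha], so the uniqueness hypothesis identifies
     them with [a]. *)
  have <- : (fun k => x k - y k) = a.
    apply: a_unique => [k|]; first by exists (x k), (y k).
    have -> : alpha = z - c by rewrite -cz addrC addKr.
    exact: representsB.
  exists (fun k => x k - gamma_digit m (x k - y k)); last first.
    exact: representsB xz (represents_gamma _).
  move=> k; rewrite gamma_digitE /slack; last by exists (x k), (y k).
  case: (xD k) (yD k) => -> [] ->; rewrite ?(subrr, sub0r, subr0, normrN, normr0).
  - by rewrite eq_sym m0 ?subrr; split=> //; left.
  - by rewrite eqNr m0 ?subrr; split=> //; left.
  - by rewrite eqxx ?subrr; split=> //; left.
  - by rewrite eq_sym m0 ?subr0; split=> //; right.
move=> [e eP ez].
have xz := representsD n _ _ _ _ ez (represents_gamma a); rewrite subrK in xz.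
have digitP k : inD m (e k + gamma_digit m (a k)) /\
    inD m (e k + gamma_digit m (a k) - a k).
  have [eD] := eP k; rewrite gamma_digitE// /slack.
  case: (inDD_cases _ (aDD k)) => ->; rewrite ?normrN ?normr0 ?subr0 ?subrr.
  - by rewrite eq_sym m0 addr0.
  - rewrite eqxx addrK; case: eD => ->; rewrite ?add0r; first by split; [right|left].
    by rewrite lez_nat leqn0 => /eqP ->; split; left.
  - rewrite eqNr m0 addr0 opprK; case: eD => ->; rewrite ?add0r.
      by split; [left|right].
    by rewrite lez_nat leqn0 => /eqP ->; split; left.
split.
  exists (fun k => e k + gamma_digit m (a k)).
  by split=> // k; case: (digitP k).
exists (z - alpha); last by rewrite subrK.
exists (fun k => e k + gamma_digit m (a k) - a k).
by split=> [k|]; [case: (digitP k)|exact: representsB].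
Qed.

Lemma exists_half_pow_le (eps : Cx R) : 0 < eps ->
  exists N, m%:R * 2^-1 ^+ N <= eps.
Proof.
rewrite complex.ltcE /= => /andP[/eqP eps_im eps_re].
have : geometric (m%:R : R) 2^-1 @ \oo --> 0.
  by apply: cvg_geometric; rewrite ger0_norm// invf_lt1// ltr1n.
move=> /cvgr0Pnorm_lt/(_ _ eps_re)[N _ /(_ N (leqnn N))].
rewrite /= ger0_norm ?mulr_ge0 ?exprn_ge0// => Neps; exists N.
rewrite [leRHS]complexE eps_im mulr0 addr0.
rewrite -(rmorph_nat (real_complex R)) -(rmorph_nat (real_complex R) 2).
by rewrite -fmorphV -rmorphXn -rmorphM lecR ltW.
Qed.

(** Digit sequences are coded as points of the Cantor space so that Tychonoff's theorem yields
    compactness. *)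
Definition digits_of_bits (f : cantor_space) (k : nat) : int :=
  if f k then m%:Z else 0.

Definition point_of_bits (f : cantor_space) : Cx R :=
  limn (series (digit_term R n (digits_of_bits f))).

Lemma represents_point_of_bits f : repr (digits_of_bits f) (point_of_bits f).
Proof.
by apply: (represents_lim n n_ge2 m) => k; rewrite /digits_of_bits; case: (f k).
Qed.

Lemma nbhs_bits_eq (f : cantor_space) N :
  nbhs f [set g : cantor_space | forall k, (k < N)%N -> g k = f k].
Proof.
elim: N => [|N IH]; first by apply: (@filterE _ (nbhs f)) => g k.
have fN : nbhs f [set g : cantor_space | g N = f N].
  exact: (@proj_continuous _ (fun=> bool) N f [set x | x = f N] (discrete_set1 _)).
apply: filterS (filterI IH fN) => g [gf gN] k.
by rewrite ltnS leq_eqVlt => /predU1P[->//|]; exact: gf.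
Qed.

(** If two bit sequences agree on the first [N] places, their points differ by [b^-N] times an
    expansion with digits in [{0, ±m}], whose modulus is at most [m]. *)
Lemma continuous_point_of_bits : continuous point_of_bits.
Proof.
move=> f; apply/cvgrPdist_le => eps /exists_half_pow_le[N Neps].
near=> g.
have gf k : (k < N)%N -> g k = f k by move: k; near: g; exact: nbhs_bits_eq.
have := represents_drop n n_ge2 N _ _
  (representsB n _ _ _ _ (represents_point_of_bits f) (represents_point_of_bits g)).
rewrite big1 ?subr0 => [/norm_represents_le|i _]; last first.
  by rewrite /digits_of_bits gf// subrr mul0r.
move=> /(_ n_ge2 m)/= le_m; apply: le_trans Neps.
have {}le_m : `|b ^+ N * (point_of_bits f - point_of_bits g)| <= m%:R.
  apply: le_m => k; rewrite /digits_of_bits.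
  by case: (f _) (g _) => -[]; rewrite ?(subrr, sub0r, subr0, normrN).
rewrite -(mulKf (expf_neq0 N (bb_neq0 n n_ge2)) (_ - _)) normrM mulrC ler_pM//.
have -> : (b ^+ N)^-1 = b^-1 ^+ N by rewrite exprVn.
by rewrite normrX lerXn2r ?nnegrE// ltW ?norm_bbV_lt.
Unshelve. all: by end_near. Qed.

Lemma compact_digit_set s : (forall k, 0 <= s k) -> compact (digit_set s).
Proof.
move=> s_ge0.
(* The constraints bear on single bits, so [A] is a product of finite sets. *)
pose A := [set f : cantor_space | forall k, [set x : bool | x -> m%:Z <= s k] (f k)].
have -> : digit_set s = point_of_bits @` A.
  apply/seteqP; split=> [t [e eP et]|_ [f fA <-]] /=.
    have ef : digits_of_bits (fun k => e k == m%:Z) = e.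
      apply/funext => k; rewrite /digits_of_bits; case: eqP => [->//|].
      by case: (eP k) => -[].
    exists (fun k => e k == m%:Z).
      by move=> k /= /eqP <-; case: (eP k).
    apply: represents_unique (represents_point_of_bits _) _; rewrite ef.
    exact: et.
  exists (digits_of_bits f); last exact: represents_point_of_bits.
  move=> k; rewrite /digits_of_bits; case: ifP => [/fA//|_]; split=> //; last by left.
  by right.
apply: continuous_compact.
  exact: continuous_subspaceT continuous_point_of_bits.
apply: (@tychonoff _ (fun=> bool) (fun k => [set x : bool | x -> m%:Z <= s k])) => k.
by apply: finite_compact; exact: (@finite_finset bool).
Qed.

End DigitSets.

(** On each residue class modulo [p] the sequence is nondecreasing with two values, so it is
    eventually constant; there are finitely many classes. *)
Lemma SEP_of_shift_le (m p : nat) (s : nat -> int) : (0 < p)%N ->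
  (forall k, inD m (s k)) -> (forall k, s k <= s (k + p)%N) -> SEP s.
Proof.
move=> p_gt0 sD s_shift.
have s_le_m k : s k <= m%:Z by case: (sD k) => ->.
have s_ge0 k : 0 <= s k by exact: inD_ge0 (sD k).
have s_shiftM k t : s k <= s (k + t * p)%N.
  elim: t => [|t IH]; first by rewrite mul0n addn0.
  by rewrite (le_trans IH)// mulSn (addnC p) addnA s_shift.
have /choice[N NP] : forall r, exists N, forall k, (k %% p)%N = r ->
    s k = m%:Z -> (N %% p)%N = r /\ s N = m%:Z.
  move=> r; have [[N NP]|noN] := pselect (exists N, (N %% p)%N = r /\ s N = m%:Z).
    by exists N.
  (* Default for a class that never reaches [m], where the claim is vacuous. *)
  by exists 0%N => k kr sk; case: noN; exists k.
(* A multiple of [p] beyond every [N r]: from [P] on, each class has attained its maximum. *)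
pose P := ((\sum_(r < p) N r).+1 * p)%N.
have N_le_P r : (r < p)%N -> (N r <= P)%N.
  move=> rp; rewrite (leq_trans _ (leq_pmulr _ p_gt0))// leqW//.
  by rewrite (bigD1 (Ordinal rp))//= leq_addr.
have s_max k k' : (P <= k)%N -> k = k' %[mod p] -> s k' <= s k.
  move=> Pk kk'; case: (sD k') => sk'; first by rewrite sk'.
  have [Nmod sN] := NP _ _ (esym kk') sk'.
  have Nk : (N (k %% p)%N <= k)%N.
    by rewrite (leq_trans _ Pk)// N_le_P// ltn_mod.
  have /dvdnP[t kE] : (p %| k - N (k %% p)%N)%N.
    by rewrite -eqn_mod_dvd// Nmod.
  by rewrite sk' -sN -[in leRHS](subnKC Nk) kE.
have P_gt0 : (0 < P)%N by rewrite muln_gt0.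
have p_dvd_P : (p %| P)%N by rewrite dvdn_mull.
(* The increments are nonnegative by [s_max]; the absolute value only casts them to [nat]. *)
exists P; split=> //; exists s, (fun k => `|s (P + k)%N - s k|%N) => k.
case: ltnP => // Pk.
have modP : (P + k %% P)%N = k %[mod p].
  by rewrite -modnDml (eqP p_dvd_P) add0n modn_dvdm.
have modP' : (P + k %% P)%N = (k %% P)%N %[mod p].
  by rewrite -modnDml (eqP p_dvd_P) add0n.
rewrite abszE ger0_norm; last by rewrite subr_ge0 s_max// leq_addr.
by rewrite addrCA subrr addr0; apply/eqP; rewrite eq_le !s_max// leq_addr.
Qed.

(** * Scalings that preserve a digit set *)

Section Similarities.
Context {R : realType} (n m : nat).
Hypotheses (n_ge2 : (2 <= n)%N) (m_gt0 : (0 < m)%N).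
Implicit Types (d e s : nat -> int) (z w : Cx R).

Local Notation b := (bb R n).
Local Notation repr := (represents R n).

Lemma represents_delta j :
  repr (fun k => if k == j then m%:Z else 0) (m%:R * b ^- j.+1).
Proof.
have := @represents_take R n j.+1 (fun k => if k == j then m%:Z else 0).
rewrite big_ord_recr /= eqxx big1 ?add0r => [|i _]; last first.
  by rewrite ltn_eqF// mul0r.
congr represents; apply/funext => k.
by have [->|] := eqVneq k j; rewrite ?ltnSn//; case: ifP.
Qed.

(* Applying [r] to the points [m b^-(j+1)] with [s j = m] shows that each digit
   position of [r m b^-(k0+1)], where [k0] is the least such [j], translates
   the set of all such [j] into itself; [r <> 1] makes one of these translations
   positive. *)
Lemma SEP_of_scaling s (r : Cx R) : (forall k, inD m (s k)) ->
  r != 0 -> r != 1 ->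
  (forall t, digit_set n m s t -> digit_set n m s (r * t)) -> SEP s.
Proof.
move=> sD r_neq0 r_neq1 rT.
have [sm|/forallNP sNm] := pselect (exists k, s k == m%:Z); last first.
  have s0 k : s k = 0 by case: (sD k) => // /eqP /sNm.
  by apply: (@SEP_of_shift_le m 1) => // k; rewrite !s0.
case: (ex_minnP sm) => k0 /eqP sk0 k0_min {sm}.
pose t j : Cx R := m%:R * b ^- j.+1.
have tT j : s j = m%:Z -> digit_set n m s (t j).
  move=> sj; exists (fun k => if k == j then m%:Z else 0).
    move=> k; case: eqP => [->|_]; first by rewrite sj; split=> //; right.
    by split; [left|exact: inD_ge0 (sD k)].
  exact: represents_delta.
have [e eP e_t] := rT _ (tT _ sk0).
have e_shift j k : s j = m%:Z -> e k = m%:Z -> s (j + k - k0)%N = m%:Z.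
  move=> sj ek.
  have k0j : (k0 <= j)%N by rewrite k0_min// sj.
  have [e' e'P e'_t] := rT _ (tT _ sj).
  (* The point [r * t j] has the admissible expansion [e'] and also the expansion [e] shifted by
     [j - k0]; they coincide by [represents_inj]. *)
  have := represents_shift n (j - k0) _ _ e_t.
  have -> : b ^- (j - k0) * (r * t k0) = r * t j.
    by rewrite /t mulrCA [b ^- _ * _]mulrCA -invfM -exprD addnS subnK.
  move=> shift_t.
  have /(congr1 (@^~ (j + k - k0)%N)) /= : e' =
      (fun k => if (k < j - k0)%N then 0 else e (k - (j - k0))%N).
    apply: (represents_inj n m n_ge2 m_gt0 _ _ _ _ _ e'_t shift_t) => i.
      by case: (e'P i).
    by case: ifP => _; [left|case: (eP (i - (j - k0))%N)].
  rewrite addnC -addnBA// ltnNge leq_addl /= addnK ek => e'm.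
  have [_] := e'P (k + (j - k0))%N; rewrite e'm.
  by case: (sD (k + (j - k0))%N) => ->//; rewrite lez_nat leqn0 => /eqP ->.
have [[k1 [k1k0 ek1]]|/forallNP e_k0] :=
    pselect (exists k, k != k0 /\ e k = m%:Z).
  have k0k1 : (k0 < k1)%N.
    rewrite ltn_neqAle eq_sym k1k0 k0_min//.
    have [_] := eP k1; rewrite ek1.
    by case: (sD k1) => ->//; rewrite lez_nat leqn0 => /eqP ->.
  apply: (@SEP_of_shift_le m (k1 - k0)) => // [|k]; first by rewrite subn_gt0.
  case: (sD k) => sk; first by rewrite sk; exact: inD_ge0 (sD _).
  by rewrite addnBA ?(ltnW k0k1)// (e_shift k k1) ?sk.
have e0 k : k != k0 -> e k = 0.
  by move=> kk0; case: (eP k) => -[//|ek _]; case: (e_k0 k).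
have t_neq0 : t k0 != 0.
  by rewrite mulf_neq0 ?invr_eq0 ?expf_neq0 ?bb_neq0// pnatr_eq0 -lt0n.
(* With no digit [m] away from [k0], the point [r * t k0] is 0 or [t k0], so [r] would be 0 or 1. *)
exfalso; case: (eP k0) => -[] ek0 _.
  have eE : e = (fun=> 0).
    by apply/funext => k; have [->|/e0] := eqVneq k k0.
  rewrite eE in e_t; have /eqP := represents_unique n _ _ _ e_t (represents0 n).
  by rewrite mulf_eq0 (negbTE r_neq0) (negbTE t_neq0).
have eE : e = (fun k => if k == k0 then m%:Z else 0).
  by apply/funext => k; have [->|/e0 ->//] := eqVneq k k0.
rewrite eE in e_t.
have /eqP := represents_unique n _ _ _ e_t (represents_delta k0).
rewrite -[X in _ == X]mul1r -subr_eq0 -mulrBl mulf_eq0 (negbTE t_neq0) orbF.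
by rewrite subr_eq0 (negbTE r_neq1).
Qed.

(** After multiplication by [b^-p], the digits [y] fill the first block of length [p] and the digits
    [z] the second. *)
Lemma sum_digit_blocks p (y z : nat -> int) :
  \sum_(l < p) ((y l)%:~R * b ^+ (p - l.+1) + (z l)%:~R * b ^- l.+1) =
  b ^+ p * (\sum_(l < p) (y l)%:~R * b ^- l.+1)
    + \sum_(l < p) (z l)%:~R * b ^- l.+1.
Proof.
rewrite big_split /= mulr_sumr; congr (_ + _); apply: eq_bigr => l _.
have bX : b ^+ p = b ^+ (p - l.+1) * b ^+ l.+1 by rewrite -exprD subnK.
by rewrite mulrCA bX mulfK// expf_neq0 ?bb_neq0.
Qed.

(** * Block decomposition for a strongly eventually periodic [s] *)

Section Periodic.
Variables (s : nat -> int) (p : nat) (as_ : nat -> int) (us : nat -> nat).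
Hypothesis sD : forall k, inD m (s k).
Hypothesis sE : forall k,
  s k = if (k < p)%N then as_ k else as_ (k %% p)%N + (us (k %% p)%N)%:Z.

Definition block_digits (y z : nat -> int) := forall l, (l < p)%N ->
  inD m (y l) /\ inD m (z l) /\ y l <= as_ l /\ z l <= (us l)%:Z.

Let s_ge0 k : 0 <= s k. Proof. exact: inD_ge0 (sD k). Qed.

Let s_head k : (k < p)%N -> s k = as_ k. Proof. by rewrite sE => ->. Qed.

Let s_second k : (k < p)%N -> s (p + k)%N = s k + (us k)%:Z.
Proof. by move=> kp; rewrite sE ltnNge leq_addr /= modnDl modn_small// s_head. Qed.

Let s_tail k : (p <= k)%N -> s (p + k)%N = s k.
Proof. by move=> pk; rewrite sE (sE k) !ltnNge leq_addr pk /= modnDl. Qed.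

Lemma digit_set_block (y z : nat -> int) t :
  block_digits y z -> digit_set n m s t ->
  digit_set n m s (b ^- p *
    (t + \sum_(l < p) ((y l)%:~R * b ^+ (p - l.+1) + (z l)%:~R * b ^- l.+1))).
Proof.
move=> yz [e eP et].
pose e' k := e k + if (k < p)%N then z k else 0.
exists (fun k => if (k < p)%N then y k else e' (k - p)%N); last first.
  rewrite sum_digit_blocks addrCA mulrDr (mulKf (expf_neq0 p (bb_neq0 n n_ge2))).
  have := @represents_cat R n p (fun k => if (k < p)%N then y k else e' (k - p)%N).
  under eq_bigr do rewrite ltn_ord.
  apply; have := representsD n _ _ _ _ et (represents_take n p z).
  congr represents; apply/funext => k.
  by rewrite /= [(p + k < p)%N]ltnNge leq_addr /= addKn.
move=> k; case: ltnP => kp.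
  by have [yD [_ [yle _]]] := yz k kp; rewrite s_head.
have -> : s k = s (p + (k - p))%N by rewrite subnKC.
rewrite /e'; move: (k - p)%N => {kp} {}k.
have [eD ele] := eP k; case: ltnP => kp; last by rewrite addr0 s_tail.
have [_ [zD [_ zle]]] := yz k kp; rewrite s_second// lerD//; split=> //.
case: eD ele => ek ele; case: zD zle => zk zle; rewrite ek zk ?add0r ?addr0.
- by left.
- by right.
- by right.
(* Two digits [m] at one place would give [2m <= s (p + k) <= m]. *)
have := lerD ele zle; rewrite -s_second// ek zk => mm.
have : s (p + k)%N <= m%:Z by case: (sD (p + k)%N) => ->.
by move=> /(le_trans mm); rewrite gerDl lez_nat leqn0 (gtn_eqF m_gt0).
Qed.

(* The digits of the second block are given to the point when the first block
   is free there, and to the translation otherwise. *)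
Lemma digit_set_unblock w : digit_set n m s w ->
  exists (y z : nat -> int) (t : Cx R),
  [/\ block_digits y z, digit_set n m s t & w = b ^- p *
    (t + \sum_(l < p) ((y l)%:~R * b ^+ (p - l.+1) + (z l)%:~R * b ^- l.+1))].
Proof.
move=> [e eP ew].
pose z l := if s l == 0 then e (p + l)%N else 0.
exists e, z, (b ^+ p * (w - \sum_(l < p) (e l)%:~R * b ^- l.+1)
              - \sum_(l < p) (z l)%:~R * b ^- l.+1); split.
- move=> l lp; have [eD ele] := eP l; have [eD' ele'] := eP (p + l)%N.
  rewrite -s_head//; split=> //; rewrite /z; case: eqP => sl.
    by rewrite s_second// sl add0r in ele'.
  by split; [left|].
- exists (fun k => e (p + k)%N - if (k < p)%N then z k else 0); last first.
    exact: representsB (represents_drop n n_ge2 p _ _ ew) (represents_take n p z).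
  move=> k; have [eD ele] := eP (p + k)%N; case: ltnP => kp; last first.
    by rewrite subr0 -s_tail.
  rewrite /z; case: eqP => sk; first by rewrite subrr s_ge0; split=> //; left.
  rewrite subr0; split=> //; case: (sD k) => // ->.
  by case: eD => ->.
- rewrite sum_digit_blocks addrA [X in _ = _ * (X + _)]addrAC.
  by rewrite subrK -mulrDr subrK (mulKf (expf_neq0 p (bb_neq0 n n_ge2))).
Qed.

End Periodic.

Lemma contracting_similarity_block p c w : (0 < p)%N ->
  contracting_similarity R (fun x => b ^- p * (x + c - w) + w).
Proof.
(* The norm takes values in [R[i]]; its real part is the required real ratio. *)
move=> p_gt0; exists (complex.Re `|b ^- p|).
have normE : ((complex.Re `|b ^- p|)%:C)%C = `|b ^- p|.
  by rewrite normc_def.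
split=> [|x y]; last first.
  rewrite normE -normrM; congr `|_|; rewrite opprD addrACA subrr addr0 -mulrBr.
  by rewrite opprD addrACA subrr addr0 opprD addrACA subrr addr0.
rewrite -!ltcR normE rmorph0 rmorph1.
rewrite normr_gt0 invr_eq0 expf_neq0 ?bb_neq0//=.
have -> : (b ^+ p)^-1 = b^-1 ^+ p by rewrite exprVn.
rewrite normrX exprn_ilt1 -?lt0n// (lt_trans (norm_bbV_lt n n_ge2))//.
by rewrite invf_lt1// ltr1n.
Qed.

(** A map depends only on the digits at places below [p], each with two possible values, so pairs of
    boolean functions on ['I_p] parametrise all the maps. *)
Lemma finite_block_maps (p : nat) (c w : Cx R) (Q : (nat -> int) -> (nat -> int) -> Prop) :
  (forall y z : nat -> int, Q y z -> forall l, (l < p)%N -> inD m (y l) /\ inD m (z l)) ->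
  finite_set [set f : Cx R -> Cx R | exists y z : nat -> int, Q y z /\
    f = (fun x => c * (x + \sum_(l < p) ((y l)%:~R * b ^+ (p - l.+1)
                                  + (z l)%:~R * b ^- l.+1) - w) + w)].
Proof.
move=> QD.
pose dig (Y : {ffun 'I_p -> bool}) (l : 'I_p) : int := if Y l then m%:Z else 0.
pose g (YZ : {ffun 'I_p -> bool} * {ffun 'I_p -> bool}) (x : Cx R) : Cx R :=
  c * (x + \sum_(l < p) ((dig YZ.1 l)%:~R * b ^+ (p - l.+1)
                          + (dig YZ.2 l)%:~R * b ^- l.+1) - w) + w.
apply: (@sub_finite_set _ _ (g @` setT)); last exact/finite_image/finite_finset.
move=> f [y [z [yz ->]]].
exists ([ffun l : 'I_p => y l == m%:Z], [ffun l : 'I_p => z l == m%:Z]) => //.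
apply/funext => x; rewrite /g /=; congr (_ * (_ + _ - _) + _).
have digE (v : nat -> int) (l : 'I_p) : inD m (v l) ->
    dig [ffun l : 'I_p => v l == m%:Z] l = v l.
  by rewrite /dig ffunE; case: eqP => // vm [].
by apply: eq_bigr => l _; have [yD zD] := QD _ _ yz l (ltn_ord l); rewrite !digE.
Qed.

End Similarities.

(** * Transfer between digit sets and [C(alpha)] through translation by [gamma] *)

Theorem theorem5p7 (R : realType) (n m : nat) (alpha : Cx R) (a : nat -> int) :
  (2 <= n)%N -> (2 <= m)%N -> (m <= n ^ 2)%N ->
  alpha \in E_nD R n m ->
  (forall k, inDD m (a k)) -> represents R n a alpha ->
  (forall a' : nat -> int, (forall k, inDD m (a' k)) -> represents R n a' alpha ->
     a' = a) ->
  (* (a) *)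
  ((self_similar R (C_alpha R n m alpha) /\
    exists F : set (Cx R -> Cx R),
      IFS R F /\ attractor R F (C_alpha R n m alpha) /\
      exists f, F f /\ exists r : Cx R,
        forall x, f x = r * x + (1 - r) * gamma R n m a) ->
   SEP (fun k => m%:Z - `|a k|))
  /\
  (* (b) *)
  (forall (p : nat) (as_ : nat -> int) (us : nat -> nat), (0 < p)%N ->
    (forall k, m%:Z - `|a k| =
       if (k < p)%N then as_ k else as_ (k %% p)%N + (us (k %% p)%N)%:Z) ->
    let F := [set f : Cx R -> Cx R | exists y z : nat -> int,
                (forall l, (l < p)%N ->
                   inD m (y l) /\ inD m (z l) /\ y l <= as_ l /\ z l <= (us l)%:Z) /\
                f = (fun x => bb R n ^- p *
                       (x + \sum_(l < p) ((y l)%:~R * bb R n ^+ (p - l.+1)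
                                          + (z l)%:~R * bb R n ^- l.+1)
                          - gamma R n m a) + gamma R n m a)] in
    self_similar R (C_alpha R n m alpha) /\ IFS R F /\ attractor R F (C_alpha R n m alpha)).
Proof.
move=> n_ge2 m_ge2 _ _ aDD aalpha a_unique.
have m_gt0 : (0 < m)%N by exact: ltnW.
have CP z := C_alphaP n m n_ge2 m_gt0 alpha a z aDD aalpha a_unique.
have sD k : inD m (slack m a k) by exact: slack_inD.
have s_ge0 k : 0 <= slack m a k by exact: inD_ge0 (sD k).
set g := gamma R n m a in CP *.
split=> [[_ [F [[_ [_ Fcs]] [[_ [_ FC]] [f [Ff [r fE]]]]]]]|p as_ us p_gt0 sE F].
  have [rho [/andP[rho_gt0 rho_lt1] f_sim]] := Fcs _ Ff.
  have norm_r : `|r| = (rho%:C)%C.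
    by have := f_sim 1 0; rewrite !fE mulr1 mulr0 add0r addrK subr0 normr1 mulr1.
  apply: (SEP_of_scaling n m n_ge2 m_gt0 (slack m a) r sD).
  - by rewrite -normr_gt0 norm_r ltcR.
  - apply: contraTneq rho_lt1 => r1; move: norm_r; rewrite r1 normr1 => /eqP.
    by rewrite -(rmorph1 (real_complex R)) (inj_eq (@complexI R)) => /eqP <-; rewrite ltxx.
  (* Conjugating [f] by the translation by [g] turns it into multiplication by [r]. *)
  - move=> t tT; have /CP : C_alpha R n m alpha (f (t + g)).
      by rewrite FC; exists f => //; exists (t + g) => //; apply/CP; rewrite addrK.
    by rewrite fE mulrDr mulrBl mul1r -(addrA (r * t)) (addrC (r * g)) subrK addrK.
have FIFS : IFS R F.
  split; [|split].
  - apply: (finite_block_maps n m p (bb R n ^- p) g (block_digits m p as_ us)).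
    by move=> y z yz l /yz[? []].
  (* The zero digits are allowed because [as_ l] is the slack at [l], hence nonnegative. *)
  - exists (fun x => bb R n ^- p * (x + \sum_(l < p) ((0 : int)%:~R * bb R n ^+ (p - l.+1)
                                   + (0 : int)%:~R * bb R n ^- l.+1) - g) + g).
    exists (fun=> 0), (fun=> 0); split=> // l lp; split; first by left.
    by split; [left|split=> //; have := s_ge0 l; rewrite /slack sE lp].
  - by move=> _ [y [z [_ ->]]]; exact: contracting_similarity_block.
have FC : attractor R F (C_alpha R n m alpha).
  have mapE c x : bb R n ^- p * (x + c - g) + g - g = bb R n ^- p * ((x - g) + c).
    by rewrite addrK addrAC.
  split; [|split].
  - rewrite (_ : C_alpha R n m alpha = +%R^~ g @` digit_set n m (slack m a)).
      apply: continuous_compact; last exact: compact_digit_set.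
      exact/continuous_subspaceT/continuous_addr_regular.
    apply/seteqP; split=> [z /CP zT|_ [t tT <-]]; first by exists (z - g); rewrite ?subrK.
    by apply/CP; rewrite addrK.
  - exists g; apply/CP; rewrite subrr; exists (fun=> 0); last exact: represents0.
    by move=> k; split; [left|].
  - apply/seteqP; split=> [w /CP wT|_ [_ [y [z [yz ->]]] [x /CP xT <-]]].
      have [y [z [t [yz tT wE]]]] := digit_set_unblock n m n_ge2 _ _ _ _ sD sE _ wT.
      exists (fun x => bb R n ^- p * (x + \sum_(l < p) ((y l)%:~R * bb R n ^+ (p - l.+1)
                        + (z l)%:~R * bb R n ^- l.+1) - g) + g); first by exists y, z.
      exists (t + g); first by apply/CP; rewrite addrK.
      by apply/(addIr (- g)); rewrite mapE addrK wE.
    by apply/CP; rewrite mapE; exact: (digit_set_block n m n_ge2 m_gt0 _ _ as_ us).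
by split=> //; exists F.
Qed.
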